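(* Let $R=\mathbb{Z}\oplus\bigoplus_{i\ge 1}\mathbb{Z}/2\mathbb{Z}$ be the commutative ring with componentwise addition and multiplication $(m,a)\cdot(n,b)=(mn,\,mb+na+ab)$. Then $R$ is not $1$-hereditary.
   Context: In the multiplication, $m,n\in\mathbb{Z}$, $a,b\in\bigoplus_{i\ge1}\mathbb{Z}/2\mathbb{Z}$, $ma=(ma_1,ma_2,\dots)$ and $ab=(a_1b_1,a_2b_2,\dots)$. A ring is $1$-hereditary (equivalently, semi-hereditary) if every finitely generated submodule of a finitely generated projective module is projective. *)

(* Defs.v *)
From HB Require Import structures.
From mathcomp Require Import all_boot all_order all_algebra.
From mathcomp.finmap Require Import finmap.
From mathcomp.multinomials Require Import monalg.
From mathcomp Require Import ring.

Set Implicit Arguments.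
Unset Strict Implicit.
Unset Printing Implicit Defensive.

Import GRing.Theory.
Local Open Scope ring_scope.

(* {malg 'Z_2[nat]} is used only as the additive group of finitely supported
   functions nat -> 'Z_2.  The copies of Z/2Z are indexed by i >= 0 rather
   than i >= 1. *)
Notation dsum2 := {malg 'Z_2[nat]}.

Definition dsum2_mul (a b : dsum2) : dsum2 :=
  [malg i in msupp a => a@_i * b@_i].

Lemma dsum2_mulE a b i : (dsum2_mul a b)@_i = a@_i * b@_i.
Proof.
rewrite /dsum2_mul mcoeffE; case: ifPn => // ia.
by rewrite (mcoeff_outdom ia) mul0r.
Qed.

Definition Zdsum2 := (int * dsum2)%type.
HB.instance Definition _ := GRing.Zmodule.copy Zdsum2 (int * dsum2)%type.

Definition Zdsum2_one : Zdsum2 := (1, 0).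

Definition Zdsum2_mul (x y : Zdsum2) : Zdsum2 :=
  let: (m, a) := x in
  let: (n, b) := y in
  (m * n, b *~ m + a *~ n + dsum2_mul a b).

Lemma mcoeffMz (a : dsum2) m i : (a *~ m)@_i = a@_i * m%:~R.
Proof. by rewrite (raddfMz (mcoeff i)) mulrzr. Qed.

Lemma Zdsum2_mulA : associative Zdsum2_mul.
Proof.
move=> [m a] [n b] [p c]; congr pair; first by rewrite mulrA.
apply/malgP => i.
by rewrite !(mcoeffD, mcoeffMz, dsum2_mulE) !intrM; ring.
Qed.

Lemma Zdsum2_mulC : commutative Zdsum2_mul.
Proof.
move=> [m a] [n b]; congr pair; first by rewrite mulrC.
by apply/malgP => i; rewrite !(mcoeffD, mcoeffMz, dsum2_mulE); ring.
Qed.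

Lemma Zdsum2_mul1 : left_id Zdsum2_one Zdsum2_mul.
Proof.
move=> [m a]; congr pair; first by rewrite mul1r.
apply/malgP => i.
by rewrite !(mcoeffD, mcoeffMz, dsum2_mulE) mcoeff0; ring.
Qed.

Lemma Zdsum2_mulDl : left_distributive Zdsum2_mul +%R.
Proof.
move=> [m a] [n b] [p c]; congr pair; first by rewrite mulrDl.
apply/malgP => i.
by rewrite !(mcoeffD, mcoeffMz, dsum2_mulE) !intrD; ring.
Qed.

Lemma Zdsum2_one_neq0 : Zdsum2_one != 0.
Proof. by []. Qed.

HB.instance Definition _ := GRing.Zmodule_isComNzRing.Build Zdsum2
  Zdsum2_mulA Zdsum2_mulC Zdsum2_mul1 Zdsum2_mulDl Zdsum2_one_neq0.

Definition fin_generated (R : pzRingType) (M : lmodType R) : Prop :=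
  exists (n : nat) (g : 'I_n -> M),
    forall x : M, exists c : 'I_n -> R, x = \sum_(i < n) c i *: g i.

Definition projective (R : pzRingType) (P : lmodType R) : Prop :=
  forall (M N : lmodType R) (g : {linear M -> N}) (f : {linear P -> N}),
    (forall y : N, exists x : M, g x = y) ->
    exists h : {linear P -> M}, forall p : P, g (h p) = f p.

(* As usual in the library, a submodule S of P is a boolean predicate; the
   subLmodType S is S with the module structure induced by P. *)
Definition one_hereditary (R : pzRingType) : Prop :=
  forall P : lmodType R, fin_generated P -> projective P ->
  forall (S : pred P) (N : subLmodType S),
    fin_generated N -> projective N.

(* Main.v *)
(* The annihilator of (2, 0) is the ideal 0 + (+)_i Z/2, which is not generated
   by an idempotent, so the principal ideal generated by (2, 0) is not
   projective.  Concretely, a splitting of r |-> r (2, 0) would give some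
   e = (1, b) killed by every (0, a); taking for a the indicator of an index
   outside the support of b gives a contradiction. *)
Require Import Defs.
From HB Require Import structures.
From mathcomp Require Import all_boot all_order all_algebra.
From mathcomp.finmap Require Import finmap.
From mathcomp.multinomials Require Import monalg.

Set Implicit Arguments.
Unset Strict Implicit.
Unset Printing Implicit Defensive.

Import GRing.Theory.
Local Open Scope ring_scope.

Section Generic.
Variable R : pzRingType.

Definition orbit_map (M : lmodType R) (v : M) (r : R^o) : M := (r : R) *: v.

Lemma orbit_map_linear (M : lmodType R) (v : M) : linear (orbit_map v).
Proof. by move=> a r s; rewrite /orbit_map scalerDl scalerA. Qed.

HB.instance Definition _ (M : lmodType R) (v : M) :=
  GRing.isLinear.Build R R^o M *:%R (orbit_map v) (orbit_map_linear v).

Lemma cyclic_fin_generated (M : lmodType R) (v : M) :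
  (forall x : M, exists r : R, r *: v = x) -> fin_generated M.
Proof.
move=> genv; exists 1%N, (fun=> v) => x.
by have [r <-] := genv x; exists (fun=> r); rewrite big_ord1.
Qed.

Lemma regular_fin_generated : fin_generated (R^o : lmodType R).
Proof.
by apply: (@cyclic_fin_generated _ (1 : R^o)) => x; exists x; apply: mulr1.
Qed.

(** [R^o] is free on 1, so any preimage [v] of [f 1] determines a lift, namely r |-> r v. *)
Lemma regular_projective : projective (R^o : lmodType R).
Proof.
move=> M N g f gsurj; have [v gv] := gsurj (f (1 : R^o)).
exists (orbit_map v) => r.
by rewrite /orbit_map linearZ gv -linearZ; congr (f _); apply: mulr1.
Qed.

(** Projectivity lifts the identity of [M] to a section [h] of r |-> r v. Take e = h(v): linearity
    of [h] carries every relation on [v] over to [e]. *)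
Lemma projective_cyclic_splitting (M : lmodType R) (v : M) :
  projective M -> (forall x : M, exists r : R, r *: v = x) ->
  exists e : R, e *: v = v /\ forall a : R, a *: v = 0 -> a * e = 0.
Proof.
move=> projM genv.
have [h hK] := projM R^o M (orbit_map v) idfun genv.
exists (h v); split=> [|a av0]; first exact: hK.
by rewrite -[a * _]/(a *: (h v : R^o)) -linearZ av0 linear0.
Qed.

End Generic.

(** The principal ideal of [two], given by a decidable condition because submodules are boolean
    predicates here. *)
Definition even_ideal : pred Zdsum2^o :=
  fun x => (2 %| x.1)%Z && (x.2 == 0).

Definition two : Zdsum2^o := ((2, 0) : Zdsum2).

Lemma mul_two (r : Zdsum2) : r *: two = ((r.1 * 2, 0) : Zdsum2).
Proof.
case: r => m a; congr pair; apply/malgP => i.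
rewrite mcoeffD mcoeffD mcoeffMz mcoeffMz dsum2_mulE mcoeff0 mul0r add0r.
(* The remaining term is the coefficient of [a *~ 2], which vanishes since 2 = 0 in Z/2. *)
by rewrite mulr0 addr0 [2%:~R](_ : _ = 0) ?mulr0 //; apply: val_inj.
Qed.

Lemma even_idealP (x : Zdsum2^o) :
  reflect (exists r : Zdsum2, x = r *: two) (even_ideal x).
Proof.
apply: (iffP andP) => [[/dvdzP[m xm] /eqP x0]|[r ->]].
  by exists (m, 0); rewrite mul_two -xm; case: x x0 {xm} => ? ? /= ->.
by rewrite mul_two /= dvdz_mull.
Qed.

Lemma even_ideal_submod_closed : submod_closed even_ideal.
Proof.
split=> [|a x y /even_idealP[r ->] /even_idealP[s ->]].
  by apply/even_idealP; exists 0; rewrite scale0r.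
by apply/even_idealP; exists (a * r + s); rewrite scalerDl scalerA.
Qed.

HB.instance Definition _ :=
  GRing.isSubmodClosed.Build Zdsum2 Zdsum2^o even_ideal
    even_ideal_submod_closed.

Record evenT := EvenT { even_val :> Zdsum2^o; _ : even_ideal even_val }.
HB.instance Definition _ := [isSub for even_val].
HB.instance Definition _ := [Choice of evenT by <:].
HB.instance Definition _ := [SubChoice_isSubLmodule of evenT by <:].

Lemma two_even : even_ideal two.
Proof. by rewrite /even_ideal /= eqxx. Qed.

Lemma evenT_generated (x : evenT) : exists r : Zdsum2, r *: EvenT two_even = x.
Proof.
by have /even_idealP[r xr] := valP x; exists r; apply: val_inj; rewrite linearZ xr.
Qed.

Lemma evenT_not_projective : ~ projective (evenT : lmodType Zdsum2).
Proof.
move=> /projective_cyclic_splitting /(_ evenT_generated) [[m b]].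
case=> /(congr1 val); rewrite linearZ /= mul_two => -[m2] annb.
(* Fixing [two] constrains only the integer component of (m, b); [b] stays arbitrary. *)
have {m2} m1 : m = 1 by apply: (mulIf (_ : 2 != 0 :> int)).
have [i ib] : exists i, i \notin msupp b.
  (* The support of [b] is finite, so the successor of its maximum lies outside it. *)
  exists (\max_(j <- msupp b) j).+1; apply/negP => ib.
  by have := @leq_bigmax_seq _ _ xpredT id _ ib isT; rewrite ltnn.
have /annb : ((0, << i >>) : Zdsum2) *: EvenT two_even = 0.
  by apply: val_inj; rewrite linearZ /= mul_two mul0r.
(* As b_i = 0 and m = 1, the product of (0, [<< i >>]) and (m, b) has coefficient 1 at [i], yet it
   should be 0. *)
move=> /(congr1 (fun x : Zdsum2 => x.2@_i)) /=.
rewrite mcoeffD mcoeffD !mcoeffMz dsum2_mulE (mcoeff_outdom ib).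
by rewrite m1 !mul0r mulr0 addr0 add0r mcoeffU eqxx mulr1.
Qed.

Theorem proposition38 : ~ one_hereditary Zdsum2.
Proof.
move=> hered; apply: evenT_not_projective.
apply: (hered _ (regular_fin_generated _) (@regular_projective _) even_ideal).
exact: cyclic_fin_generated evenT_generated.
Qed.
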